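(* For every $n\ge 1$ and every $\theta_n\in\Theta_n$, if $X^n\sim P_{\theta_n}$ and the prior on $\Theta_n$ is uniform, then $$P_{\theta_n}\Pi\bigl(\{\theta_n\}\bigm|X^n\bigr)\ \ge\ 1-\frac n2\,\rho(p_n,q_n)^{n/2}\,e^{\,n\rho(p_n,q_n)^{n/2}} .$$ Consequently, if $\theta_n\in\Theta_n$ and $X^n\sim P_{\theta_n}$ for all $n\ge1$, and $$n\,\rho(p_n,q_n)^{n/2}\to 0\qquad (n\to\infty),$$ then the posterior recovers the true community assignment exactly, i.e. $P_{\theta_n}\Pi(\{\theta_n\}\mid X^n)\to1$ as $n\to\infty$.
   Context: Stochastic block model with two communities: for $n\ge1$ and $0\le m\le\lfloor n/2\rfloor$ let $\Theta_{n,m}=\{\theta_n\in\{0,1\}^n:\sum_i\theta_{n,i}=m\}$, except that for even $n$ and $m=n/2$, $\Theta_{n,n/2}=\{\theta_n\in\{0,1\}^n:\sum_i\theta_{n,i}=n/2,\ \theta_{n,1}=0\}$. Let $\Theta_n=\bigcup_{m=0}^{\lfloor n/2\rfloor}\Theta_{n,m}$; it has $2^{n-1}$ elements. Let $p_n,q_n\in[0,1]$. Under $P_{\theta_n}$ the observed random graph $X^n=\{X_{ij}:1\le i<j\le n\}\in\mathscr{X}_n=\{0,1\}^{\{(i,j):1\le i<j\le n\}}$ has independent edges with $P_{\theta_n}(X_{ij}=1)=Q_{ij}(\theta_n)$, where $Q_{ij}(\theta_n)=p_n$ if $\theta_{n,i}=\theta_{n,j}$ and $Q_{ij}(\theta_n)=q_n$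 if $\theta_{n,i}\ne\theta_{n,j}$. Its probability mass function is $p_{\theta_n}(x^n)=\prod_{i<j}Q_{ij}(\theta_n)^{x_{ij}}(1-Q_{ij}(\theta_n))^{1-x_{ij}}$ (with $0^0=1$). The uniform prior gives mass $2^{-(n-1)}$ to each element of $\Theta_n$; the corresponding posterior is $\Pi(A\mid X^n)=\sum_{\theta\in A}p_{\theta}(X^n)\big/\sum_{\theta'\in\Theta_n}p_{\theta'}(X^n)$ for $A\subset\Theta_n$ (defined whenever the denominator is positive, which holds $P_{\theta_n}$-almost surely for each $\theta_n\in\Theta_n$). $P_{\theta_n}f(X^n)$ denotes the expectation of $f(X^n)$ under $P_{\theta_n}$. $\rho(p,q)=p^{1/2}q^{1/2}+(1-p)^{1/2}(1-q)^{1/2}$. *)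

(* Defs.v *)
From HB Require Import structures.
From mathcomp Require Import all_boot all_order all_algebra.
From mathcomp Require Import all_classical all_reals all_analysis.

Set Implicit Arguments.
Unset Strict Implicit.
Unset Printing Implicit Defensive.

Import Order.TTheory GRing.Theory Num.Theory.
Import numFieldNormedType.Exports.

Local Open Scope ring_scope.

(* Community assignments; the vertices 1, ..., n are numbered 0, ..., n-1, so
   that the first vertex is the one of value 0. *)
Definition assignment (n : nat) := {ffun 'I_n -> bool}.

Definition ThetaM (n m : nat) : {set assignment n} :=
  [set theta : assignment n | ((\sum_(i < n) theta i)%N == m) &&
    ((n == m.*2) ==> [forall i : 'I_n, (val i == 0%N) ==> ~~ theta i])].

Definition Theta (n : nat) : {set assignment n} :=
  (\bigcup_(m < (n./2).+1) ThetaM n m)%SET.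

Definition edge (n : nat) := {e : 'I_n * 'I_n | (e.1 < e.2)%N}.

Definition graph (n : nat) := {ffun edge n -> bool}.

Section StochasticBlockModel.
Context {R : realType}.
Implicit Types (n : nat) (p q : R).

Definition edge_prob n p q (theta : assignment n) (e : edge n) : R :=
  if theta (val e).1 == theta (val e).2 then p else q.

Definition sbm_pmf n p q (theta : assignment n) (x : graph n) : R :=
  \prod_(e : edge n)
    (edge_prob p q theta e ^+ x e * (1 - edge_prob p q theta e) ^+ ~~ x e).

Definition sbm_expectation n p q (theta : assignment n) (f : graph n -> R) : R :=
  \sum_(x : graph n) sbm_pmf p q theta x * f x.

Definition uniform_prior n (theta : assignment n) : R :=
  if theta \in Theta n then (2 ^+ n.-1)^-1 else 0.

(* When the denominator vanishes the value is 0 by the convention y / 0 = 0;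
   this happens with probability 0 under the model at any theta \in Theta n. *)
Definition posterior n p q (prior : assignment n -> R) (A : {set assignment n})
    (x : graph n) : R :=
  (\sum_(theta in A) prior theta * sbm_pmf p q theta x) /
  (\sum_(theta in Theta n) prior theta * sbm_pmf p q theta x).

Lemma posterior_uniformE n p q (A : {set assignment n}) (x : graph n) :
  A \subset Theta n ->
  posterior p q (@uniform_prior n) A x =
  (\sum_(theta in A) sbm_pmf p q theta x) /
  (\sum_(theta in Theta n) sbm_pmf p q theta x).
Proof.
move=> /fintype.subsetP AT; rewrite /posterior.
have E (B : {set assignment n}) : {subset B <= Theta n} ->
    \sum_(theta in B) @uniform_prior n theta * sbm_pmf p q theta x =
    (2 ^+ n.-1)^-1 * \sum_(theta in B) sbm_pmf p q theta x.
  move=> BT; rewrite mulr_sumr; apply: eq_bigr => t /BT tT.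
  by rewrite /uniform_prior tT.
rewrite !E //; by rewrite -mulf_div divff ?mul1r // invr_eq0 expf_neq0 // pnatr_eq0.
Qed.

Definition rho p q : R :=
  Num.sqrt p * Num.sqrt q + Num.sqrt (1 - p) * Num.sqrt (1 - q).

End StochasticBlockModel.

Arguments uniform_prior {R n} theta.

(* Main.v *)
Require Import Defs.
From HB Require Import structures.
From mathcomp Require Import all_boot all_order all_algebra.
From mathcomp Require Import all_classical all_reals all_analysis.
From mathcomp Require Import zify lra.

Set Implicit Arguments.
Unset Strict Implicit.
Unset Printing Implicit Defensive.

Import Order.TTheory GRing.Theory Num.Theory.
Import numFieldNormedType.Exports.

Local Open Scope ring_scope.

(** The expected posterior mass of the wrong assignments is controlled pair by
    pair.  With f the probability mass functions and Z the sum of the f eta over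
    Theta, the posterior mass of eta averaged under theta is
    \sum_x f theta x * f eta x / Z x, and Z >= f theta + f eta
    >= 2 sqrt (f theta * f eta); hence it is at most half the affinity
    \sum_x sqrt (f theta x * f eta x)  ([posterior_error_le_affinity]).

    Independence of the edges factorizes the affinity: an edge contributes rho
    when theta and eta disagree on whether its ends lie in the same community,
    and 1 otherwise.  The edges of disagreement are those of the cut between the
    set D of vertices where theta and eta differ and its complement, so there
    are at least k (n - k) >= k n / 2 of them, where k <= n / 2 is the size of
    the smaller of D and ~: D.  As rho <= 1, the affinity is at most r ^ k with
    r = rho ^ (n / 2)  ([sbm_affinity_le]).

    An assignment and its flip describe the same partition, and Theta contains
    at most one of the two; consequently eta is determined within Theta by the
    smaller side of the cut  ([small_side_diff_inj]).  The sum over the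
    wrong eta is therefore at most the sum of r ^ #|A| over nonempty sets A of
    vertices, that is (1 + r) ^ n - 1 <= n r exp (n r).  Together with the
    factor one half this is the bound; the limit follows by squeezing. *)

(** * Posterior error for a finite family of distributions *)

(** The inequality of arithmetic and geometric means gives
    s >= a + b >= 2 sqrt (a b), and a b = sqrt (a b) ^ 2. *)
Lemma mulr_div_le_sqrt (R : rcfType) (a b s : R) :
  0 <= a -> 0 <= b -> a + b <= s ->
  a * (b / s) <= 2^-1 * (Num.sqrt a * Num.sqrt b).
Proof.
move=> a0 b0 abs.
have u0 := sqrtr_ge0 a; have v0 := sqrtr_ge0 b.
have [->|s_neq0] := eqVneq s 0.
  by rewrite invr0 !mulr0 mulr_ge0 ?invr_ge0 ?mulr_ge0.
have s_gt0 : 0 < s by rewrite lt0r s_neq0 /=; lra.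
rewrite mulrA ler_pdivrMr //.
have uvs : 2 * (Num.sqrt a * Num.sqrt b) <= s.
  (* (sqrt a - sqrt b) ^ 2 >= 0 *)
  apply: le_trans abs; rewrite -{2}(sqr_sqrtr a0) -{2}(sqr_sqrtr b0).
  have := sqr_ge0 (Num.sqrt a - Num.sqrt b); nra.
rewrite -{1}(sqr_sqrtr a0) -{1}(sqr_sqrtr b0) -exprMn expr2.
have := ler_wpM2r (mulr_ge0 u0 v0) uvs; lra.
Qed.

(** Where f t vanishes both sides contribute nothing, so a vanishing
    normalizer does no harm; elsewhere the posterior masses add up to 1 and each
    wrong s is compared with t alone, by dropping all other terms of the
    normalizer. *)
Lemma posterior_error_le_affinity (R : rcfType) (T X : finType)
    (f : T -> X -> R) (S : {set T}) (t : T) :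
  (forall s x, 0 <= f s x) -> t \in S -> \sum_x f t x = 1 ->
  1 - \sum_x f t x * (f t x / \sum_(s in S) f s x) <=
  2^-1 * \sum_(s in (S :\ t)%SET) \sum_x Num.sqrt (f t x) * Num.sqrt (f s x).
Proof.
move=> f0 tS f1; rewrite -{1}f1 -sumrB exchange_big mulr_sumr.
apply: ler_sum => x _.
set Z := \sum_(s in S) f s x.
have ZE : Z = f t x + \sum_(s in (S :\ t)%SET) f s x by rewrite /Z (big_setD1 t).
have rest0 : 0 <= \sum_(s in (S :\ t)%SET) f s x by exact: sumr_ge0.
have -> : f t x - f t x * (f t x / Z) =
    \sum_(s in (S :\ t)%SET) f t x * (f s x / Z).
  have [->|ft0] := eqVneq (f t x) 0.
    by rewrite !mul0r subr0 big1 // => s _; rewrite mul0r.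
  have Z0 : Z != 0.
    by rewrite gt_eqF // ZE ltr_wpDr // lt0r ft0 f0.
  rewrite -mulr_sumr -mulr_suml -{1}(mulr1 (f t x)) -mulrBr; congr (_ * _).
  by rewrite -{1}(divff Z0) -mulrBl {1}ZE addrC addKr.
rewrite mulr_sumr; apply: ler_sum => s; rewrite finset.in_setD1 => /andP[st sS].
apply: mulr_div_le_sqrt => //; rewrite ZE lerD2l.
by rewrite (big_setD1 s) ?finset.in_setD1 ?st //= lerDl sumr_ge0.
Qed.

(** * The affinity of two stochastic block models *)

Lemma sqrtr_prod (R : rcfType) (I : finType) (F : I -> R) :
  (forall i, 0 <= F i) -> Num.sqrt (\prod_i F i) = \prod_i Num.sqrt (F i).
Proof.
move=> F0.
suff [] : 0 <= \prod_i F i /\ Num.sqrt (\prod_i F i) = \prod_i Num.sqrt (F i) by [].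
elim/big_ind2 : _ => [|a a' b b' [a0 <-] [b0 <-]|i _].
- by rewrite sqrtr1.
- by rewrite sqrtrM // mulr_ge0.
- by [].
Qed.

Section Affinity.
Context {R : realType}.
Implicit Types (n : nat) (p q : R).

Lemma rhoC p q : rho p q = rho q p.
Proof. by rewrite /rho mulrC [X in _ + X]mulrC. Qed.

Lemma rho_self p : 0 <= p <= 1 -> rho p p = 1.
Proof.
by move=> /andP[p0 p1]; rewrite /rho -!expr2 !sqr_sqrtr ?subr_ge0 // addrC subrK.
Qed.

Lemma rho_ge0 p q : 0 <= rho p q.
Proof. by rewrite addr_ge0 // mulr_ge0 ?sqrtr_ge0. Qed.

(** Since rho p p = rho q q = 1, the difference 2 - 2 rho p q is the squared
    Hellinger distance between the two Bernoulli distributions. *)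
Lemma rho_le1 p q : 0 <= p <= 1 -> 0 <= q <= 1 -> rho p q <= 1.
Proof.
move=> p01 q01; have := rho_self p01; have := rho_self q01; rewrite /rho.
have := sqr_ge0 (Num.sqrt p - Num.sqrt q).
have := sqr_ge0 (Num.sqrt (1 - p) - Num.sqrt (1 - q)).
nra.
Qed.

Lemma edge_prob01 n p q (theta : assignment n) e :
  0 <= p <= 1 -> 0 <= q <= 1 -> 0 <= edge_prob p q theta e <= 1.
Proof. by rewrite /edge_prob; case: ifP. Qed.

Lemma edge_pmf_ge0 n p q (theta : assignment n) e (b : bool) :
  0 <= p <= 1 -> 0 <= q <= 1 ->
  0 <= edge_prob p q theta e ^+ b * (1 - edge_prob p q theta e) ^+ ~~ b.
Proof.
move=> p01 q01; have /andP[Q0 Q1] := edge_prob01 theta e p01 q01.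
by rewrite mulr_ge0 // exprn_ge0 // subr_ge0.
Qed.

Lemma sbm_pmf_ge0 n p q (theta : assignment n) x :
  0 <= p <= 1 -> 0 <= q <= 1 -> 0 <= sbm_pmf p q theta x.
Proof. by move=> p01 q01; apply: prodr_ge0 => e _; exact: edge_pmf_ge0. Qed.

(** Both mass functions are products over the edges, and summing a product
    over all graphs is the same as multiplying the sums over the two states of
    each edge. *)
Lemma sbm_affinityE n p q (theta eta : assignment n) :
  0 <= p <= 1 -> 0 <= q <= 1 ->
  \sum_x Num.sqrt (sbm_pmf p q theta x) * Num.sqrt (sbm_pmf p q eta x) =
  \prod_e rho (edge_prob p q theta e) (edge_prob p q eta e).
Proof.
move=> p01 q01.
pose F e (b : bool) :=
  Num.sqrt (edge_prob p q theta e ^+ b * (1 - edge_prob p q theta e) ^+ ~~ b) *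
  Num.sqrt (edge_prob p q eta e ^+ b * (1 - edge_prob p q eta e) ^+ ~~ b).
transitivity (\prod_e \sum_b F e b); last first.
  by apply: eq_bigr => e _; rewrite big_bool /F /= !expr1 !expr0 !mulr1 !mul1r.
rewrite bigA_distr_bigA; apply: eq_bigr => x _.
by rewrite /sbm_pmf !sqrtr_prod -?big_split // => e; exact: edge_pmf_ge0.
Qed.

(** The total mass is the affinity of the distribution with itself. *)
Lemma sbm_pmf_sum1 n p q (theta : assignment n) :
  0 <= p <= 1 -> 0 <= q <= 1 -> \sum_x sbm_pmf p q theta x = 1.
Proof.
move=> p01 q01; transitivity
  (\sum_x Num.sqrt (sbm_pmf p q theta x) * Num.sqrt (sbm_pmf p q theta x)).
  by apply: eq_bigr => x _; rewrite -expr2 sqr_sqrtr ?sbm_pmf_ge0.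
by rewrite sbm_affinityE // big1 // => e _; rewrite rho_self ?edge_prob01.
Qed.

End Affinity.

(** * Counting the edges on which two assignments disagree *)

Definition diff_set n (theta eta : assignment n) : {set 'I_n} :=
  [set i | theta i != eta i]%SET.

Definition cut_edges n (D : {set 'I_n}) : {set edge n} :=
  [set e : edge n | ((val e).1 \in D) != ((val e).2 \in D)]%SET.

Lemma leq_card_cut_edges n (D : {set 'I_n}) :
  (#|D| * (n - #|D|) <= #|cut_edges D|)%N.
Proof.
have -> : (n - #|D| = #|~: D|)%N by rewrite -[X in (X - _)%N]card_ord -(cardsC D) addKn.
rewrite -cardsX.
(* Orient each cut edge from D to its complement. *)
pose orient (e : edge n) : 'I_n * 'I_n :=
  if (val e).1 \in D then val e else ((val e).2, (val e).1).
apply: leq_trans (leq_imset_card orient (cut_edges D)).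
apply/subset_leq_card/fintype.subsetP => -[i j].
rewrite finset.in_setX finset.in_setC /= => /andP[iD jD].
have [ij|ji|ij] := ltngtP i j; last by move: jD; rewrite -(ord_inj ij) iD.
- apply/imsetP; exists (exist _ (i, j) ij : edge n).
    by rewrite inE /= iD (negbTE jD).
  by rewrite /orient /= iD.
- apply/imsetP; exists (exist _ (j, i) ji : edge n).
    by rewrite inE /= iD (negbTE jD).
  by rewrite /orient /= (negbTE jD).
Qed.

(** Whether the ends of an edge are separated by theta XOR eta is the exclusive
    or of whether they are separated by theta and by eta. *)
Lemma cut_edges_disagree n (theta eta : assignment n) (e : edge n) :
  (e \in cut_edges (diff_set theta eta)) =
  ((theta (val e).1 == theta (val e).2) != (eta (val e).1 == eta (val e).2)).
Proof.
rewrite !inE.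
by case: (theta _); case: (theta _); case: (eta _); case: (eta _).
Qed.

Lemma sbm_affinity_cut (R : realType) n (p q : R) (theta eta : assignment n) :
  0 <= p <= 1 -> 0 <= q <= 1 ->
  \sum_x Num.sqrt (sbm_pmf p q theta x) * Num.sqrt (sbm_pmf p q eta x) =
  rho p q ^+ #|cut_edges (diff_set theta eta)|.
Proof.
move=> p01 q01; rewrite sbm_affinityE // -prodr_const [RHS]big_mkcond /=.
apply: eq_bigr => e _; rewrite cut_edges_disagree /edge_prob.
by do 2 case: ifP => _ //=; rewrite ?rho_self // rhoC.
Qed.

(** A cut does not tell which side is which; the smaller one is kept because
    its size k satisfies n - k >= n / 2. *)
Definition small_side n (D : {set 'I_n}) : {set 'I_n} :=
  (if (#|D|.*2 <= n)%N then D else ~: D)%SET.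

(** With k the size of the small side, the cut has at least k (n - k) edges and
    2 (n - k) >= n.  Comparing squares keeps all exponents natural: it suffices
    that rho ^ (2 #|cut|) <= rho ^ (n k) = (r ^ k) ^ 2. *)
Lemma sbm_affinity_le (R : realType) n (p q r : R) (theta eta : assignment n) :
  0 <= p <= 1 -> 0 <= q <= 1 -> 0 <= r -> r ^+ 2 = rho p q ^+ n ->
  \sum_x Num.sqrt (sbm_pmf p q theta x) * Num.sqrt (sbm_pmf p q eta x) <=
  r ^+ #|small_side (diff_set theta eta)|.
Proof.
move=> p01 q01 r0 r2; rewrite sbm_affinity_cut //.
set D := diff_set theta eta; set k := #|small_side D|.
rewrite -(@ler_pXn2r _ 2) ?nnegrE ?exprn_ge0 ?rho_ge0 //.
rewrite -!exprM [(k * 2)%N]mulnC !exprM r2 -!exprM.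
apply: ler_wiXn2l; rewrite ?rho_ge0 ?rho_le1 //.
have D_le := leq_card_cut_edges D.
have DC : (#|D| + #|~: D|%SET = n)%N by rewrite cardsC card_ord.
by rewrite /k /small_side; case: ifP => ?; nia.
Qed.

(** * Assignments and sets of vertices *)

Definition flip n (eta : assignment n) : assignment n := [ffun i => ~~ eta i].

(** The two community sizes add up to n and neither exceeds n / 2, so both are
    n / 2; but then each assignment would send the first vertex to false. *)
Lemma flip_notin_Theta n (eta : assignment n) :
  (0 < n)%N -> eta \in Theta n -> flip eta \notin Theta n.
Proof.
case: n eta => // n eta _ /bigcupP[m _]; rewrite inE => /andP[/eqP wm mP].
apply/negP => /bigcupP[m' _]; rewrite inE => /andP[/eqP wm' mP'].
have wD : (m + m' = n.+1)%N.
  rewrite -wm -wm' -big_split /= -[RHS]card_ord -sum1_card.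
  by apply: eq_bigr => i _; rewrite ffunE; case: (eta i).
have m_le := ltn_ord m; have m'_le := ltn_ord m'.
have [nm nm'] : n.+1 = m.*2 /\ n.+1 = m'.*2 by lia.
have /forallP/(_ ord0) /= := implyP mP (introT eqP nm).
have /forallP/(_ ord0) /= := implyP mP' (introT eqP nm').
by rewrite ffunE => /negbTE ->.
Qed.

(** The small side determines the cut, hence eta up to a flip, and the flip of
    eta lies outside Theta. *)
Lemma small_side_diff_inj n (theta : assignment n) :
  (0 < n)%N -> {in Theta n &, injective (fun eta => small_side (diff_set theta eta))}.
Proof.
move=> n0 eta eta' etaT etaT' /= E.
have sameP : diff_set theta eta = diff_set theta eta' -> eta = eta'.
  move=> /finset.setP H; apply/ffunP => i; have := H i; rewrite !inE.
  by case: (theta i); case: (eta i); case: (eta' i).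
have flipP : diff_set theta eta = (~: diff_set theta eta')%SET -> eta = flip eta'.
  move=> /finset.setP H; apply/ffunP => i; have := H i; rewrite !inE ffunE.
  by case: (theta i); case: (eta i); case: (eta' i).
have noflip : eta <> flip eta'.
  by move=> e; have := flip_notin_Theta n0 etaT'; rewrite -e etaT.
move: E; rewrite /small_side; case: ifP => _; case: ifP => _ E.
- exact: sameP.
- by case: noflip; exact: flipP.
- by case: noflip; apply: flipP; rewrite -E finset.setCK.
- by apply: sameP; exact: finset.setC_inj.
Qed.

Lemma sum_exp_card (R : comNzRingType) n (r : R) :
  \sum_(A : {set 'I_n}) r ^+ #|A| = (1 + r) ^+ n.
Proof.
transitivity (\prod_(i < n) (r + 1)); last by rewrite prodr_const card_ord addrC.
rewrite bigA_distr; apply: eq_bigr => A _.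
by rewrite -prodr_const [LHS]big_mkcond.
Qed.

(** By injectivity the sum over all of Theta is at most the sum of r ^ #|A| over
    all sets A; the 1 that is subtracted is the term of theta itself, whose
    small side is empty. *)
Lemma sum_exp_small_side_le (R : realType) n (r : R) (theta : assignment n) :
  (0 < n)%N -> 0 <= r -> theta \in Theta n ->
  \sum_(eta in (Theta n :\ theta)%SET) r ^+ #|small_side (diff_set theta eta)|
  <= (1 + r) ^+ n - 1.
Proof.
move=> n0 r0 thT; rewrite lerBrDl -sum_exp_card.
have small0 : #|small_side (diff_set theta theta)| = 0%N.
  have -> : diff_set theta theta = finset.set0.
    by apply/finset.setP => i; rewrite !inE eqxx.
  by rewrite /small_side cards0 leq0n cards0.
have -> : 1 = r ^+ #|small_side (diff_set theta theta)| by rewrite small0.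
rewrite -(big_setD1 (aop := +%R) theta) //=.
rewrite -(big_imset (fun A : {set 'I_n} => r ^+ #|A|) (@small_side_diff_inj n theta n0)).
set I := imset _ _.
rewrite [leRHS](bigID (mem I)) /= lerDl sumr_ge0 // => A _.
exact: exprn_ge0.
Qed.

Lemma exprD1_sub1_le (R : realType) n (r : R) :
  0 <= r -> (1 + r) ^+ n - 1 <= n%:R * r * expR (n%:R * r).
Proof.
move=> r0; set x := n%:R * r.
apply: (@le_trans _ _ (expR x - 1)).
  rewrite lerD2r /x expRM_natl lerXn2r ?nnegrE ?expR_ge0 ?addr_ge0 //.
  exact: expR_ge1Dx.
(* This is 1 - x <= expR (- x), multiplied by expR x. *)
have := ler_wpM2r (expR_ge0 x) (expR_ge1Dx (- x)).
by rewrite -expRD addNr expR0; lra.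
Qed.

(** * The lower bound and exact recovery *)

Section Recovery.
Context {R : realType}.
Context (n : nat) (p q : R) (theta : assignment n).
Context (p01 : 0 <= p <= 1) (q01 : 0 <= q <= 1) (thT : theta \in Theta n).

Let success : R := sbm_expectation p q theta
  (posterior p q uniform_prior [set theta]%SET).

Lemma successE : success = \sum_x sbm_pmf p q theta x *
  (sbm_pmf p q theta x / \sum_(eta in Theta n) sbm_pmf p q eta x).
Proof.
apply: eq_bigr => x _; rewrite posterior_uniformE ?big_set1 //.
by rewrite finset.sub1set.
Qed.

Lemma success_ge : (0 < n)%N ->
  success >= 1 - n%:R / 2 * rho p q `^ (n%:R / 2)
              * expR (n%:R * rho p q `^ (n%:R / 2)).
Proof.
move=> n0; set r := rho p q `^ (n%:R / 2).
have r0 : 0 <= r by exact: powR_ge0.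
have r2 : r ^+ 2 = rho p q ^+ n.
  by rewrite -powR_mulrn // -powRrM divfK // powR_mulrn ?rho_ge0.
have err : 1 - success <= 2^-1 * (n%:R * r * expR (n%:R * r)).
  rewrite successE; apply: le_trans
    (posterior_error_le_affinity _ thT (sbm_pmf_sum1 theta p01 q01)) _.
    by move=> eta x; exact: sbm_pmf_ge0.
  rewrite ler_pM2l ?invr_gt0 //; apply: le_trans (exprD1_sub1_le n r0).
  apply: le_trans (sum_exp_small_side_le n0 r0 thT).
  by apply: ler_sum => eta _; exact: sbm_affinity_le.
rewrite -/r in err *; move: err; set e := expR _; lra.
Qed.

Lemma success_le1 : success <= 1.
Proof.
rewrite successE -(sbm_pmf_sum1 theta p01 q01); apply: ler_sum => x _.
have f0 eta : 0 <= sbm_pmf p q eta x by exact: sbm_pmf_ge0.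
rewrite ler_piMr //.
set Z := \sum_(_ in _) _.
have fZ : sbm_pmf p q theta x <= Z by rewrite /Z (big_setD1 theta) //= lerDl sumr_ge0.
have [->|Z0] := eqVneq Z 0; first by rewrite invr0 mulr0.
by rewrite ler_pdivrMr ?mul1r // lt0r Z0 (le_trans (f0 theta)).
Qed.

End Recovery.

Local Open Scope classical_set_scope.
Local Open Scope ring_scope.

Theorem theorem4p1 (R : realType) (p q : nat -> R)
    (hp : forall n : nat, (1 <= n)%N -> 0 <= p n <= 1)
    (hq : forall n : nat, (1 <= n)%N -> 0 <= q n <= 1) :
  (forall (n : nat) (theta : assignment n), (1 <= n)%N -> theta \in Theta n ->
     sbm_expectation (p n) (q n) theta
       (posterior (p n) (q n) uniform_prior [set theta]%SET)
     >= 1 - n%:R / 2 * rho (p n) (q n) `^ (n%:R / 2)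
              * expR (n%:R * rho (p n) (q n) `^ (n%:R / 2))) /\
  (forall theta : forall n : nat, assignment n,
     (forall n : nat, (1 <= n)%N -> theta n \in Theta n) ->
     (n%:R * rho (p n) (q n) `^ (n%:R / 2)) @[n --> \oo] --> (0 : R) ->
     sbm_expectation (p n) (q n) (theta n)
       (posterior (p n) (q n) uniform_prior [set theta n]%SET)
       @[n --> \oo] --> (1 : R)).
Proof.
split=> [n theta n0 thT|theta thT].
  exact: success_ge (hp n n0) (hq n n0) thT n0.
set u := fun n : nat => n%:R * rho (p n) (q n) `^ (n%:R / 2) => u0.
apply: (@squeeze_cvgr _ _ _ _ (fun n => 1 - 2^-1 * (u n * expR (u n))) (fun=> 1)).
- near=> n; have n0 : (1 <= n)%N by near: n; exact: nbhs_infty_ge.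
  rewrite (success_le1 (hp n n0) (hq n n0) (thT n n0)) andbT.
  apply: le_trans (success_ge (hp n n0) (hq n n0) (thT n n0) n0).
  rewrite /u; set e := expR _; lra.
- have expu : expR (u n) @[n --> \oo] --> (1 : R).
    rewrite -expR0; exact: continuous_cvg (@continuous_expR R 0) u0.
  have := cvgB (cvg_cst (1 : R)) (cvgM (cvg_cst (2^-1 : R)) (cvgM u0 expu)).
  by rewrite mul0r mulr0 subr0; exact.
- exact: cvg_cst.
Unshelve. all: by end_near. Qed.
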